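(* Let $E$ and $F$ be Banach lattices with bases $(e_i)$ and $(f_j)$, respectively. Then the double sequence $(e_i\otimes f_j)_{i,j}$ is disjoint in $E\otimes_{|\pi|}F$. Moreover, this sequence is a $1$-unconditional basis of $E\otimes_{|\pi|}F$ (under any enumeration).
   Context: All Banach lattices are real. A Banach lattice with a basis $(e_i)$ is a Banach lattice $E$ with a Schauder basis $(e_i)$ that defines the order: $x=\sum_{i=1}^\infty x_ie_i$ satisfies $x\ge0$ if and only if $x_i\ge0$ for all $i$. (Such a basis is automatically $1$-unconditional.) Fremlin tensor product: for Banach lattices $E,F$, the norm of $u$ in the algebraic tensor product $E\otimes F$ is $\|u\|_{|\pi|}=\sup\|\hat\varphi(u)\|$, where the supremum is over all Banach lattices $G$ and all positive bilinear maps $\varphi\colon E\times F\to G$ (i.e. $\varphi(x,y)\ge 0$ whenever $x,y\ge 0$) with $\|\varphi\|=\sup\{\|\varphi(x,y)\|:\|x\|\le1,\|y\|\le1\}\le 1$, and $\hat\varphi$ is the induced linear map on $E\otimes F$. The completion of $E\otimes F$ in this norm is a Banach lattice (its positive cone is the closure of the convex cone generated by $x\otimes y$ with $x,y\ge0$), denoted $E\otimes_{|\pi|}F$. It has the universal property that continuous positive bilinear maps $\varphi\colon E\times F\to G$ correspond one-to-one and norm-preservingly to positive operators $T\colon E\otimes_{|\pi|}F\to G$ with $T(x\otimes y)=\varphi(x,y)$; $T$ is a lattice homomorphism if and only if $|\varphi(x,y)|=\varphi(|x|,|y|)$ for all $x,y$. *)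

(* Defs.v *)
From HB Require Import structures.
From mathcomp Require Import all_boot all_order all_algebra.
From mathcomp Require Import sesquilinear.
From mathcomp Require Import boolp classical_sets functions reals ereal.
From mathcomp Require Import topology normedtype sequences.

Set Implicit Arguments.
Unset Strict Implicit.
Unset Printing Implicit Defensive.

Import Order.TTheory GRing.Theory Num.Theory.
Import numFieldNormedType.Exports.

Local Open Scope classical_set_scope.
Local Open Scope ring_scope.

(* HB accepts no join of completeNormedModType and latticeType, since it already
   resolves zmodType and latticeType to realDomainType, whose norm is valued in
   the space itself.  The order is therefore carried by its own operations, with
   the axioms of Order.POrder_isLattice. *)
HB.mixin Record isBanachLattice (R : realType) V of CompleteNormedModule R V := {
  bl_le : rel V ;
  bl_meet : V -> V -> V ;
  bl_join : V -> V -> V ;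
  bl_le_refl : reflexive bl_le ;
  bl_le_anti : antisymmetric bl_le ;
  bl_le_trans : transitive bl_le ;
  bl_lexI : forall x y z : V, bl_le x (bl_meet y z) = bl_le x y && bl_le x z ;
  bl_leUx : forall x y z : V, bl_le (bl_join x y) z = bl_le x z && bl_le y z ;
  bl_leD2r : forall x y z : V, bl_le x y -> bl_le (x + z) (y + z) ;
  bl_scale_ge0 : forall (a : R) (x : V),
    0 <= a -> bl_le 0 x -> bl_le 0 (a *: x) ;
  bl_le_norm : forall x y : V,
    bl_le (bl_join x (- x)) (bl_join y (- y)) -> `|x| <= `|y|
}.

#[short(type="banachLatticeType")]
HB.structure Definition BanachLattice (R : realType) :=
  { V of isBanachLattice R V & CompleteNormedModule R V }.

(* The notation `|x| is the norm of x, not its modulus. *)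
Definition modulus (R : realType) (E : banachLatticeType R) (x : E) : E :=
  bl_join x (- x).

Section Bases.
Context {R : realType}.

Definition expansion (V : normedModType R) (e : nat -> V) (a : nat -> R)
    (x : V) : Prop :=
  series (fun i => a i *: e i) @ \oo --> x.

Definition schauder_basis (V : normedModType R) (e : nat -> V) : Prop :=
  forall x : V, exists! a : nat -> R, expansion e a x.

Definition unconditional_basis (V : normedModType R) (e : nat -> V) : Prop :=
  schauder_basis e /\
  forall (x : V) (a : nat -> R), expansion e a x ->
    forall s : nat -> nat, bijective s -> expansion (e \o s) (a \o s) x.

Definition one_unconditional_basis (V : normedModType R) (e : nat -> V) :
    Prop :=
  unconditional_basis e /\
  forall (n : nat) (a : nat -> R) (eps : nat -> bool),
    `|\sum_(i < n) ((-1) ^+ eps i * a i) *: e i| <= `|\sum_(i < n) a i *: e i|.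

Definition lattice_basis (E : banachLatticeType R) (e : nat -> E) : Prop :=
  schauder_basis e /\
  forall (x : E) (a : nat -> R), expansion e a x ->
    (bl_le 0 x <-> forall i, 0 <= a i).

Definition lattice_disjoint (E : banachLatticeType R) (x y : E) : Prop :=
  bl_meet (modulus x) (modulus y) = 0.

Definition disjoint_family (E : banachLatticeType R) (I : Type) (u : I -> E) :
    Prop :=
  forall i j : I, i <> j -> lattice_disjoint (u i) (u j).

End Bases.

Section FremlinTensorProduct.
Context {R : realType}.
Variables E F : banachLatticeType R.

Definition positive_bilinear (G : banachLatticeType R)
    (phi : {bilinear E -> F -> G}) : Prop :=
  forall (x : E) (y : F), bl_le 0 x -> bl_le 0 y -> bl_le 0 (phi x y).

Definition bilinear_norm (G : banachLatticeType R)
    (phi : {bilinear E -> F -> G}) : \bar R :=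
  ereal_sup [set r | exists (x : E) (y : F),
    [/\ `|x| <= 1, `|y| <= 1 & r = `|phi x y|%:E]].

(* Elements of the algebraic tensor product are written as finite sums
   \sum_(p <- u) p.1 (x) p.2 with u : seq (E * F); on such a sum the linear map
   induced by phi takes the value induced phi u.  Two sequences representing
   the same tensor have the same image under every bilinear map, so all the
   notions below depend only on the tensor. *)
Definition induced (G : banachLatticeType R) (phi : {bilinear E -> F -> G})
    (u : seq (E * F)) : G :=
  \sum_(p <- u) phi p.1 p.2.

Definition fremlin_norm (u : seq (E * F)) : \bar R :=
  ereal_sup [set r | exists (G : banachLatticeType R)
                            (phi : {bilinear E -> F -> G}),
    [/\ positive_bilinear phi, (bilinear_norm phi <= 1)%E
      & r = `|induced phi u|%:E]].

(* The Banach lattice T, with tens x y standing for x (x) y, is the Fremlin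
   tensor product of E and F, i.e. the completion of the algebraic tensor
   product in the norm fremlin_norm (T is complete, and the linear map induced
   by tens is isometric with dense range), ordered by the closure of the convex
   cone generated by the x (x) y with x, y >= 0.  Nonnegative coefficients in
   the elements of this cone are absorbed by the left factors. *)
Record is_fremlin_tensor (T : banachLatticeType R)
    (tens : {bilinear E -> F -> T}) : Prop := IsFremlinTensor {
  fremlin_isometric : forall u : seq (E * F),
    `|induced tens u|%:E = fremlin_norm u ;
  fremlin_dense : dense (range (induced tens)) ;
  fremlin_cone : forall w : T, bl_le 0 w <->
    closure [set induced tens u | u in
      [set u : seq (E * F) | forall p, p \in u -> bl_le 0 p.1 /\ bl_le 0 p.2]] w
}.

End FremlinTensorProduct.

(* Main.v *)
(* The coordinate functionals e_i^* and f_j^* are positive, so (x, y) |->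
   e_i^*(x) f_j^*(y) is a bounded positive bilinear form and extends to a
   continuous positive functional on T.  Likewise P_n (x) Q_n, with P_n and Q_n
   the partial sum projections, is a contraction of T, and it tends to the
   identity pointwise because it does so on the dense range of the algebraic
   tensor product.  Since the cone of T is closed, the order of T is therefore
   determined by the coordinates e_i^* (x) f_j^*.  In a Banach lattice with such
   a coordinatewise order the unit vectors are disjoint and every coordinate
   projection is a contraction; if moreover the vectors of finite support are
   dense, then every enumeration of the unit vectors is a 1-unconditional
   basis. *)
Require Import Defs.
From HB Require Import structures.
From mathcomp Require Import all_boot all_order all_algebra.
From mathcomp Require Import sesquilinear.
From mathcomp Require Import boolp classical_sets functions reals ereal.
From mathcomp Require Import topology normedtype sequences.
From mathcomp Require Import ring.

Set Implicit Arguments.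
Unset Strict Implicit.
Unset Printing Implicit Defensive.

Import Order.TTheory GRing.Theory Num.Theory.
Import numFieldNormedType.Exports.

Local Open Scope classical_set_scope.
Local Open Scope ring_scope.

(** * Bounded functionals and elementary order rules *)

Lemma bounded_scalar_continuous (R : realType) (V : normedModType R)
    (f : {scalar V}) (C : R) :
  (forall x, `|f x| <= C * `|x|) -> continuous (f : V -> R).
Proof.
move=> fC x; apply/cvgrPdist_lt => eps eps0.
(* [C] may be zero or negative; [|C| + 1] is a positive bound in its place. *)
have C1 : 0 < `|C| + 1 by rewrite ltr_wpDl.
near=> y.
have -> : f x - f y = f (x - y) by rewrite linearB.
apply: (le_lt_trans (fC _)).
apply: (@le_lt_trans _ _ ((`|C| + 1) * `|x - y|)).
  by rewrite ler_wpM2r// (le_trans (ler_norm C))// lerDl.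
rewrite mulrC -ltr_pdivlMr//; near: y.
have /cvgrPdist_lt := @cvg_id _ (nbhs x); apply.
by rewrite divr_gt0.
Unshelve. all: by end_near. Qed.

Section BanachLatticeOrder.
Context {R : realType} {V : banachLatticeType R}.
Implicit Types x y z : V.

Lemma bl_subr_ge0 x y : bl_le 0 (y - x) = bl_le x y.
Proof.
apply/idP/idP => [/(bl_leD2r _ _ x)|/(bl_leD2r _ _ (- x))].
  by rewrite add0r subrK.
by rewrite subrr.
Qed.

Lemma bl_addr_ge0 x y : bl_le 0 x -> bl_le 0 y -> bl_le 0 (x + y).
Proof.
move=> x0 y0; apply: (bl_le_trans _ _ _ x0).
by have := bl_leD2r _ _ x y0; rewrite add0r addrC.
Qed.

Lemma bl_sumr_ge0 (J : Type) (r : seq J) (P : pred J) (v : J -> V) :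
  (forall j, P j -> bl_le 0 (v j)) -> bl_le 0 (\sum_(j <- r | P j) v j).
Proof.
by move=> v0; elim/big_ind: _ => //; [exact: bl_le_refl|exact: bl_addr_ge0].
Qed.

End BanachLatticeOrder.

(** * Banach lattices ordered by coordinates *)

(** Common ground of the two factors, indexed by [nat], and of their tensor product, indexed by
    [nat * nat]. *)
Record coordinate_system (R : realType) (V : banachLatticeType R) (I : eqType)
    (c : I -> {scalar V}) (u : I -> V) : Prop := CoordinateSystem {
  coord_unit : forall i j, c i (u j) = (i == j)%:R ;
  coord_ge0 : forall x : V, bl_le 0 x <-> forall i, 0 <= c i x }.

Section CoordinateSystem.
Context {R : realType} {V : banachLatticeType R} {I : eqType}.
Context {c : I -> {scalar V}} {u : I -> V}.
Hypothesis cu : coordinate_system c u.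
Implicit Types x y : V.

Lemma coord_le x y : bl_le x y <-> forall i, c i x <= c i y.
Proof.
rewrite -bl_subr_ge0 (coord_ge0 cu).
by split=> xy i; have := xy i; rewrite linearB subr_ge0.
Qed.

Lemma coord_inj x y : (forall i, c i x = c i y) -> x = y.
Proof.
by move=> xy; apply: bl_le_anti; apply/andP; split; apply/coord_le => i;
  rewrite xy.
Qed.

(** The modulus is the least upper bound of [x] and [- x]: if its coordinate at [i] exceeded
    [|c i x|] by some [d > 0], then [modulus x - d *: u i] would be a smaller upper bound. *)
Lemma coord_modulus i x : c i (modulus x) = `|c i x|.
Proof.
have := bl_le_refl (modulus x); rewrite {1}/modulus bl_leUx.
move=> /andP[/coord_le xm /coord_le Nxm].
have le_m j : `|c j x| <= c j (modulus x).
  by rewrite ler_norml xm andbT lerNl -linearN Nxm.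
apply/eqP; rewrite eq_le le_m andbT -subr_le0.
set d := _ - _.
have cz j : c j (modulus x - d *: u i) = c j (modulus x) - d * (j == i)%:R.
  by rewrite linearB linearZ /= (coord_unit cu).
have le_z j : `|c j x| <= c j (modulus x - d *: u i).
  rewrite cz; case: eqP => [->|_]; last by rewrite mulr0 subr0.
  by rewrite mulr1 /d opprB addrC subrK.
have : bl_le (modulus x) (modulus x - d *: u i).
  rewrite {1}/modulus bl_leUx; apply/andP; split; apply/coord_le => j.
    exact: le_trans (ler_norm _) (le_z j).
  by rewrite linearN (le_trans _ (le_z j))// -normrN ler_norm.
by move/coord_le/(_ i); rewrite cz eqxx mulr1 lerBrDr gerDl.
Qed.

(** Moduli are computed coordinatewise, so this is the lattice norm axiom; the contraction estimates
    for coordinate projections rest on it. *)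
Lemma coord_norm_le x y : (forall i, `|c i x| <= `|c i y|) -> `|x| <= `|y|.
Proof.
by move=> xy; apply/bl_le_norm/coord_le => i; rewrite !coord_modulus.
Qed.

(** At each [k] the meet is bounded by the coordinates of both moduli, and one of these vanishes
    since [i <> j]. *)
Lemma coord_disjoint : disjoint_family u.
Proof.
move=> i j /eqP ij; rewrite /lattice_disjoint; set z := bl_meet _ _.
have := bl_le_refl z; rewrite {2}/z bl_lexI => /andP[/coord_le zi /coord_le zj].
apply: bl_le_anti; apply/andP; split.
  apply/coord_le => k; rewrite linear0.
  have [ki|ki] := eqVneq k i.
    by have := zj k; rewrite coord_modulus (coord_unit cu) ki (negPf ij) normr0.
  by have := zi k; rewrite coord_modulus (coord_unit cu) (negPf ki) normr0.
rewrite bl_lexI; apply/andP; split; apply/coord_le => k;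
  by rewrite linear0 coord_modulus.
Qed.

Lemma coord_unit_gt0 i : 0 < `|u i|.
Proof.
rewrite normr_gt0; apply/eqP => ui0.
by have := coord_unit cu i i; rewrite ui0 linear0 eqxx => /eqP;
  rewrite eq_sym oner_eq0.
Qed.

Lemma coord_unit_ge0 i : bl_le 0 (u i).
Proof. by apply/(coord_ge0 cu) => j; rewrite (coord_unit cu). Qed.

(** The vector [|c i x| *: u i] is dominated by [x] in every coordinate. Boundedness of the
    coordinate functionals comes from here. *)
Lemma coord_bound i x : `|u i| * `|c i x| <= `|x|.
Proof.
rewrite mulrC -[in X in X * _]normr_id -normrZ.
apply: coord_norm_le => j; rewrite linearZ /= (coord_unit cu).
by case: eqP => [->|_]; rewrite ?mulr1 ?mulr0 ?normr0// normr_id.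
Qed.

Lemma coord_continuous i : continuous (c i : V -> R).
Proof.
apply: (@bounded_scalar_continuous _ _ _ `|u i|^-1) => x.
by rewrite mulrC ler_pdivlMr ?coord_unit_gt0// mulrC coord_bound.
Qed.

Section Enumeration.
Variable s : nat -> I.
Hypothesis s_bij : bijective s.

Lemma coord_partial_sum (a : nat -> R) n k :
  c (s k) (series (fun j => a j *: u (s j)) n) = if (k < n)%N then a k else 0.
Proof.
rewrite /series /= linear_sum /= big_mkord.
under eq_bigr do rewrite linearZ /= (coord_unit cu) (bij_eq s_bij).
case: ifPn => [kn|nk].
  rewrite (bigD1 (Ordinal kn)) //= eqxx mulr1 big1 ?addr0 // => j.
  by rewrite -val_eqE /= eq_sym => /negPf ->; rewrite mulr0.
rewrite big1 // => j _; case: eqP => [kj|_]; last by rewrite mulr0.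
by rewrite kj ltn_ord in nk.
Qed.

(** By continuity [c (s k)] passes to the limit, and on the partial sums it is eventually constant,
    equal to [a k]. *)
Lemma coord_expansion (a : nat -> R) x :
  expansion (u \o s) a x -> forall k, a k = c (s k) x.
Proof.
move=> ax k.
have lim_c : c (s k) (series (fun j => a j *: u (s j)) n) @[n --> \oo] -->
    c (s k) x.
  by apply: continuous_cvg ax; exact: coord_continuous.
apply: (cvg_unique _ _ lim_c) => //.
apply: cvg_near_cst; near=> n.
rewrite coord_partial_sum ifT //; near: n; exact: nbhs_infty_gt.
Unshelve. all: by end_near. Qed.

(** The partial sums [S] are linear contractions that eventually fix each vector of finite support;
    density carries convergence over to every [x]. *)
Lemma coord_sum_expansion :
  dense [set x | exists r : seq I, forall i, i \notin r -> c i x = 0] ->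
  forall x, expansion (u \o s) (fun k => c (s k) x) x.
Proof.
move=> fin_dense x; have [t sK tK] := s_bij.
pose S x := series (fun k => c (s k) x *: u (s k)).
have cS y n i : c i (S y n) = if (t i < n)%N then c i y else 0.
  by rewrite -[i in LHS]tK coord_partial_sum tK.
have S_le y n : `|S y n| <= `|y|.
  by apply: coord_norm_le => i; rewrite cS; case: ifP; rewrite ?normr0.
apply/cvgrPdist_lt => eps eps0.
have eps2 : 0 < eps / 2 by rewrite divr_gt0.
have [|y [xy [r yr]]] := fin_dense (ball x (eps / 2)) _ (ball_open _ _).
  by exists x; exact: ballxx.
(* The threshold is the stage by which [s] has enumerated all of the support [r]. *)
have Sy n : (\max_(i <- r) (t i).+1 <= n)%N -> S y n = y.
  move=> rn; apply: coord_inj => i; rewrite cS; case: ifPn => // tin.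
  rewrite yr //; apply: contra tin => ir; apply: leq_trans rn.
  by rewrite (big_rem i) //= leq_maxl.
near=> n.
have SB : S (x - y) n = S x n - S y n.
  apply: coord_inj => i; rewrite linearB /= !cS linearB /=.
  by case: ifP; rewrite ?subr0.
have -> : x - series (fun k => c (s k) x *: (u \o s) k) n =
    (x - y) - S (x - y) n.
  rewrite SB Sy; last by near: n; exact: nbhs_infty_ge.
  by rewrite opprB addrA subrK.
rewrite (le_lt_trans (ler_normB _ _))// (splitr eps).
have xy2 : `|x - y| < eps / 2 by move: xy; rewrite -ball_normE.
by rewrite ltr_leD // (le_trans (S_le _ _))// ltW.
Unshelve. all: by end_near. Qed.

End Enumeration.

(** A permuted enumeration [s \o p] is again an enumeration, so the expansion lemma applies to it
    directly. Sign changes preserve the absolute values of coordinates, hence the norm bound. *)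
Lemma coord_one_unconditional (s : nat -> I) : bijective s ->
  dense [set x | exists r : seq I, forall i, i \notin r -> c i x = 0] ->
  one_unconditional_basis (u \o s).
Proof.
move=> s_bij fin_dense; split; first split.
- move=> x; exists (fun k => c (s k) x); split.
    exact: coord_sum_expansion.
  by move=> a ax; apply/funext => k; rewrite -(coord_expansion s_bij ax).
- move=> x a ax p p_bij.
  have -> : a \o p = fun k => c (s (p k)) x.
    by apply/funext => k /=; exact: coord_expansion.
  exact: (coord_sum_expansion (bij_comp s_bij p_bij)).
- move=> n a eps; have [t sK tK] := s_bij; apply: coord_norm_le => i.
  rewrite -(big_mkord xpredT (fun k => ((-1) ^+ eps k * a k) *: (u \o s) k)).
  rewrite -(big_mkord xpredT (fun k => a k *: (u \o s) k)).
  rewrite -(tK i) !(coord_partial_sum s_bij).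
  by case: ifP => // _; rewrite normrM normrX normrN1 expr1n mul1r.
Qed.

End CoordinateSystem.

(** * Density arguments and extension of functionals *)

Lemma dense_closed (T : topologicalType) (D C : set T) :
  dense D -> closed C -> D `<=` C -> forall x, C x.
Proof.
move=> dD cC DC x; apply: contrapT => nCx.
have [|y [nCy /DC]] := dD (~` C) _ (closed_openC cC); last by [].
by exists x.
Qed.

Lemma dense_near (R : realType) (V : normedModType R) (D : set V) (x : V)
    (eps : R) : dense D -> 0 < eps -> exists2 y, D y & `|x - y| < eps.
Proof.
move=> dD eps0.
have [|y [xy Dy]] := dD (ball x eps) _ (ball_open _ _).
  by exists x; exact: ballxx.
by exists y => //; move: xy; rewrite -ball_normE.
Qed.

(* McShane's formula extends the C-Lipschitz map whose graph is H; linearity of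
   the extension then follows by density. *)
Lemma dense_extension (R : realType) (V : normedModType R) (C : R)
    (H : set (V * R)) :
  0 <= C ->
  (forall a x s y t, H (x, s) -> H (y, t) -> H (a *: x + y, a * s + t)) ->
  (forall x s, H (x, s) -> `|s| <= C * `|x|) ->
  dense [set x | exists s, H (x, s)] ->
  exists2 f : {scalar V}, (forall x s, H (x, s) -> f x = s)
    & forall x, `|f x| <= C * `|x|.
Proof.
move=> C0 Hlin Hbnd Hdense.
have Hlip x s y t : H (x, s) -> H (y, t) -> s - t <= C * `|x - y|.
  move=> Hxs Hyt; have := Hlin (-1) _ _ _ _ Hyt Hxs.
  rewrite scaleN1r mulN1r ![- _ + _]addrC => /Hbnd.
  exact: le_trans (ler_norm _).
pose A x := [set r | exists y t, H (y, t) /\ r = t + C * `|x - y|].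
pose f x := inf (A x).
have lbA x y t : H (y, t) -> lbound (A x) (t - C * `|x - y|).
  move=> Hyt _ [z [s [Hzs ->]]].
  rewrite lerBlDr -addrA -mulrDr -lerBlDl.
  apply: (le_trans (Hlip _ _ _ _ Hyt Hzs)); rewrite ler_wpM2l//.
  by rewrite [leRHS]addrC (distrC x y) ler_distD.
have fE x y t : H (y, t) -> `|f x - t| <= C * `|x - y|.
  move=> Hyt; rewrite ler_distl; apply/andP; split.
    by apply: lb_le_inf; [exists (t + C * `|x - y|), y, t|exact: lbA].
  by apply: inf_lbound; [exists (t - C * `|x - y|); exact: lbA|exists y, t].
have f_lin : scalar f.
  move=> a x y; apply/eqP; rewrite -subr_eq0 -normr_le0.
  apply/ler_addgt0Pr => eps eps0; rewrite add0r.
  (* Two error terms of at most [C * (|a| + 1) * d] each add up to [(K - 1) * d]; the extra [1]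
     keeps [K] positive when [C = 0]. *)
  pose K := 2 * (C * (`|a| + 1)) + 1.
  have K0 : 0 < K by rewrite ltr_wpDl// !mulr_ge0// addr_ge0.
  have [x' [s Hs] xx'] := dense_near x Hdense (divr_gt0 eps0 K0).
  have [y' [t Ht] yy'] := dense_near y Hdense (divr_gt0 eps0 K0).
  set d := eps / K in xx' yy'.
  have -> : f (a *: x + y) - (a * f x + f y) =
      (f (a *: x + y) - (a * s + t)) - (a * (f x - s) + (f y - t)).
    by ring.
  have le1 : `|f (a *: x + y) - (a * s + t)| <= C * (`|a| * d + d).
    apply: (le_trans (fE _ _ _ (Hlin a _ _ _ _ Hs Ht))).
    rewrite ler_wpM2l// opprD addrACA -scalerBr (le_trans (ler_normD _ _))//.
    by refine (lerD _ _); rewrite ?normrZ ?ler_wpM2l// ltW.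
  have le2 : `|a * (f x - s) + (f y - t)| <= C * (`|a| * d + d).
    rewrite (le_trans (ler_normD _ _))// [leRHS]mulrDr.
    refine (lerD _ _); rewrite ?normrM.
      rewrite mulrCA ler_wpM2l// (le_trans (fE _ _ _ Hs))// ler_wpM2l//.
      exact: ltW.
    by rewrite (le_trans (fE _ _ _ Ht))// ler_wpM2l// ltW.
  rewrite (le_trans (ler_normB _ _))// (le_trans (lerD le1 le2))//.
  have -> : C * (`|a| * d + d) + C * (`|a| * d + d) = (K - 1) * d.
    by rewrite /K; ring.
  by rewrite mulrBl mul1r /d mulrC divfK ?gt_eqF// gerBl ltW ?divr_gt0.
pose F : {scalar V} := HB.pack f (GRing.isLinear.Build R V R *%R f f_lin).
exists F => [x s Hxs|x] /=.
  by apply/eqP; rewrite -subr_eq0 -normr_le0 (le_trans (fE _ _ _ Hxs))//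
    subrr normr0 mulr0.
have [y [s Hys] _] := dense_near x Hdense ltr01.
(* Comparing with the graph point at the origin turns the Lipschitz estimate [fE] into the norm
   bound. *)
have H0 : H (0, 0) by have := Hlin (-1) _ _ _ _ Hys Hys;
  rewrite scaleN1r mulN1r !addNr.
by have := fE x _ _ H0; rewrite !subr0.
Qed.

(** * The real line as a Banach lattice *)

Section RealLine.
Variable R : realType.

Let real_le_norm (x y : R^o) :
  Order.max x (- x) <= Order.max y (- y) -> `|x| <= `|y|.
Proof. by rewrite !maxrN. Qed.

Let real_scale_ge0 (a : R) (x : R^o) : 0 <= a -> 0 <= x -> 0 <= a *: x.
Proof. exact: mulr_ge0. Qed.

Let real_leD2r (x y z : R^o) : x <= y -> x + z <= y + z.
Proof. by rewrite lerD2r. Qed.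

(** Admits scalar-valued bilinear forms to the supremum defining [fremlin_norm]. *)
HB.instance Definition _ := isBanachLattice.Build R R^o
  (@le_refl _ R) (@le_anti _ R) (@le_trans _ R) (@le_min _ R) 
  (fun x y z => ge_max z x y)
  real_leD2r real_scale_ge0 real_le_norm.

End RealLine.

(** * Partial sum projections and coordinates of a lattice basis *)

Section PartialSums.
Context {R : realType} {V : normedModType R}.
Variables (c : nat -> {scalar V}) (u : nat -> V) (n : nat).

Definition partial_sum (x : V) : V := series (fun i => c i x *: u i) n.

Fact partial_sum_is_linear : linear partial_sum.
Proof.
move=> a x y; rewrite /partial_sum /series /= scaler_sumr -big_split /=.
by apply: eq_bigr => i _; rewrite linearP scalerDl scalerA.
Qed.

HB.instance Definition _ :=
  GRing.isLinear.Build R V V *:%R partial_sum partial_sum_is_linear.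

End PartialSums.

Lemma coord_partial_sum_norm_le (R : realType)
    (V : banachLatticeType R) (cV : nat -> {scalar V}) (v : nat -> V) n x :
  coordinate_system cV v -> `|partial_sum cV v n x| <= `|x|.
Proof.
move=> cv; apply: (coord_norm_le cv) => i.
rewrite (coord_partial_sum cv (s := id)); last by exists id.
by case: ifP => // _; rewrite normr0.
Qed.

Lemma coord_partial_sum_ge0 (R : realType)
    (V : banachLatticeType R) (cV : nat -> {scalar V}) (v : nat -> V) n x :
  coordinate_system cV v -> bl_le 0 x -> bl_le 0 (partial_sum cV v n x).
Proof.
move=> cv /(coord_ge0 cv) x0; apply/(coord_ge0 cv) => i.
rewrite (coord_partial_sum cv (s := id)); last by exists id.
by case: ifP.
Qed.

(** Uniqueness of expansions makes the chosen coefficients linear in the vector. *)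
Lemma lattice_basis_coordinates (R : realType) (E : banachLatticeType R)
    (e : nat -> E) : lattice_basis e ->
  exists2 c : nat -> {scalar E}, coordinate_system c e
    & forall x, partial_sum c e n x @[n --> \oo] --> x.
Proof.
move=> [e_basis e_order]; have [b bP] := choice e_basis.
have b_exp x : expansion e (b x) x by have [] := bP x.
have b_uniq x a : expansion e a x -> b x = a by have [_] := bP x; apply.
have b_lin i : scalar (b^~ i).
  move=> k x y; rewrite (b_uniq _ (fun i => k * b x i + b y i)) //.
  rewrite /expansion.
  have -> : series (fun i => (k * b x i + b y i) *: e i) =
      (fun n => k *: series (fun i => b x i *: e i) n +
                series (fun i => b y i *: e i) n).
    apply/funext => n; rewrite /series /= scaler_sumr -big_split /=.
    by apply: eq_bigr => j _; rewrite scalerDl scalerA.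
  by apply: cvgD; [apply: cvgZr|]; exact: b_exp.
pose c i : {scalar E} :=
  HB.pack (fun x => b x i) (GRing.isLinear.Build R E R *%R _ (b_lin i)).
exists c; last exact: b_exp.
split=> [i j|x] /=; last by apply: e_order; exact: b_exp.
(* From [n = j + 1] on, the partial sums for the unit sequence at [j] equal [e j]. *)
rewrite (b_uniq _ (fun i => (i == j)%:R)) //; apply: cvg_near_cst; near=> n.
have jn : (j < n)%N by near: n; exact: nbhs_infty_gt.
rewrite /series /= big_mkord (bigD1 (Ordinal jn)) //= eqxx scale1r.
rewrite big1 ?addr0//.
by move=> k; rewrite -val_eqE /= => /negPf ->; rewrite scale0r.
Unshelve. all: by end_near. Qed.

(** * Bilinear maps and their norm *)

Section Bilinear.
Context {R : realType} {E F : banachLatticeType R}.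

Section ScalarTensor.
Variables (k : R) (A : {scalar E}) (B : {scalar F}).

(** The factor [k] scales the product form to norm at most 1. *)
Definition scalar_tensor (x : E) (y : F) : R^o := k * (A x * B y).

Fact scalar_tensor_is_bilinear : bilinear_for *:%R *:%R scalar_tensor.
Proof.
by split=> [z|z] a x y; rewrite /scalar_tensor linearP /= /GRing.scale /=; ring.
Qed.

HB.instance Definition _ := bilinear_isBilinear.Build R E F R^o *:%R *:%R
  scalar_tensor scalar_tensor_is_bilinear.

End ScalarTensor.

Section Precomposition.
Context {G : banachLatticeType R}.
Variables (phi : {bilinear E -> F -> G}).
Variables (P : {linear E -> E}) (Q : {linear F -> F}).

(** For [phi = tens], the induced map is [P] tensor [Q] on algebraic tensors. *)
Definition bilinear_precomp (x : E) (y : F) : G := phi (P x) (Q y).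

Fact bilinear_precomp_is_bilinear : bilinear_for *:%R *:%R bilinear_precomp.
Proof.
by split=> [z|z] a x y; rewrite /bilinear_precomp linearP ?linearPl ?linearPr.
Qed.

HB.instance Definition _ := bilinear_isBilinear.Build R E F G *:%R *:%R
  bilinear_precomp bilinear_precomp_is_bilinear.

End Precomposition.

Lemma bilinear_norm_le1 (G : banachLatticeType R)
    (phi : {bilinear E -> F -> G}) :
  (bilinear_norm phi <= 1)%E <-> forall x y, `|phi x y| <= `|x| * `|y|.
Proof.
split=> [phi1 x y|phi_le]; last first.
  apply: ge_ereal_sup => _ [x [y [x1 y1 ->]]]; rewrite lee_fin.
  by rewrite (le_trans (phi_le x y))// mulr_ile1.
have [->|x0] := eqVneq x 0; first by rewrite linear0l !normr0 mul0r.
have [->|y0] := eqVneq y 0; first by rewrite linear0r !normr0 mulr0.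
have : (`|phi (`|x|^-1 *: x) (`|y|^-1 *: y)|%:E <= 1)%E.
  apply: le_trans phi1; apply: ereal_sup_ubound.
  exists (`|x|^-1 *: x), (`|y|^-1 *: y); split=> //;
    by rewrite normrZ normfV normr_id mulVf ?normr_eq0.
rewrite linearZl linearZr /= lee_fin !normrZ !normfV !normr_id mulrA -invfM.
by rewrite ler_pdivrMl ?mulr_gt0 ?normr_gt0// mulr1.
Qed.

End Bilinear.

(** * Norm, cone and product functionals of the Fremlin tensor product *)

Section FremlinTensor.
Context {R : realType} {E F T : banachLatticeType R}.
Context {tens : {bilinear E -> F -> T}}.
Hypothesis hT : is_fremlin_tensor tens.

Lemma induced_cat (G : banachLatticeType R) (phi : {bilinear E -> F -> G}) u v :
  induced phi (u ++ v) = induced phi u + induced phi v.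
Proof. by rewrite /induced big_cat. Qed.

Lemma induced_scale (G : banachLatticeType R) (phi : {bilinear E -> F -> G})
    (a : R) u :
  induced phi [seq (a *: p.1, p.2) | p <- u] = a *: induced phi u.
Proof.
rewrite /induced big_map scaler_sumr; apply: eq_bigr => p _.
by rewrite linearZl.
Qed.

Lemma induced1 (G : banachLatticeType R) (phi : {bilinear E -> F -> G}) x y :
  induced phi [:: (x, y)] = phi x y.
Proof. by rewrite /induced big_seq1. Qed.

(** Such a [phi] is one of the competitors in the supremum, which equals the norm of
    [induced tens u] by isometry. *)
Lemma induced_le (G : banachLatticeType R) (phi : {bilinear E -> F -> G}) :
  positive_bilinear phi -> (forall x y, `|phi x y| <= `|x| * `|y|) ->
  forall u, `|induced phi u| <= `|induced tens u|.
Proof.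
move=> phi0 phi_le u; have phi1 := (bilinear_norm_le1 phi).2 phi_le.
rewrite -lee_fin (fremlin_isometric hT).
by apply: ereal_sup_ubound; exists G, phi.
Qed.

Lemma tens_norm_le x y : `|tens x y| <= `|x| * `|y|.
Proof.
rewrite -lee_fin -induced1 (fremlin_isometric hT).
apply: ge_ereal_sup => _ [G [phi [_ phi1 ->]]].
by rewrite lee_fin induced1 (bilinear_norm_le1 phi).1.
Qed.

Lemma tens_ge0 : positive_bilinear tens.
Proof.
move=> x y x0 y0; apply/(fremlin_cone hT)/subset_closure.
exists [:: (x, y)]; last by rewrite induced1.
by move=> p; rewrite inE => /eqP ->.
Qed.

Lemma closed_bl_ge0 : closed [set w : T | bl_le 0 w].
Proof.
have -> : [set w : T | bl_le 0 w] = closure [set induced tens u | u in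
    [set u : seq (E * F) | forall p, p \in u -> bl_le 0 p.1 /\ bl_le 0 p.2]].
  by apply/seteqP; split=> w /(fremlin_cone hT).
exact: closed_closure.
Qed.

(** After scaling by [k] the product form is a positive contraction, so [induced_le] bounds it by
    the norm of [T]; it then extends from the dense range with constant [k^-1]. *)
Lemma tensor_functional (A : {scalar E}) (B : {scalar F}) (k : R) :
  0 < k -> (forall x y, k * (`|A x| * `|B y|) <= `|x| * `|y|) ->
  (forall x, bl_le 0 x -> 0 <= A x) -> (forall y, bl_le 0 y -> 0 <= B y) ->
  exists f : {scalar T}, [/\ continuous (f : T -> R),
    forall x y, f (tens x y) = A x * B y
    & forall w, bl_le 0 w -> 0 <= f w].
Proof.
move=> k0 AB A0 B0.
pose S u : R := \sum_(p <- u) A p.1 * B p.2.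
have kS u : k * S u = induced (scalar_tensor k A B) u.
  by rewrite /S mulr_sumr.
(* A graph is used because many sequences represent one tensor; linearity and the bound together
   make it single-valued. *)
pose H : set (T * R) := [set (induced tens u, S u) | u in setT].
have [|a x s y t [u _ [<- <-]] [v _ [<- <-]]|x s [u _ [<- <-]]||f fH f_le] :=
    @dense_extension _ _ k^-1 H.
- by rewrite invr_ge0 ltW.
- exists ([seq (a *: p.1, p.2) | p <- u] ++ v) => //.
  rewrite induced_cat induced_scale; congr (_, _).
  rewrite /S big_cat big_map mulr_sumr; congr (_ + _).
  by apply: eq_bigr => p _; rewrite linearZ /= mulrA.
- rewrite ler_pdivlMl// -{1}(gtr0_norm k0) -normrM kS.
  apply: induced_le => [x' y' x0 y0|x' y'].
    suff : 0 <= k * (A x' * B y') by [].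
    by rewrite mulr_ge0 ?(ltW k0) ?mulr_ge0 ?A0 ?B0.
  by rewrite /= /scalar_tensor !normrM (gtr0_norm k0).
- move=> O O0 oO; have [w [Ow [u _ uw]]] := fremlin_dense hT O0 oO.
  by exists w; split=> //; exists (S u), u; rewrite // uw.
have f_cont : continuous (f : T -> R) by exact: bounded_scalar_continuous f_le.
have fS u : f (induced tens u) = S u by apply: fH; exists u.
exists f; split=> // [x y|w /(fremlin_cone hT) wT].
  by rewrite -induced1 fS /S big_seq1.
(* Positivity on the generated cone passes to its closure, the cone of [T]. *)
have f0 : closed [set w | 0 <= f w].
  exact: ((continuous_closedP (f : T -> R)).1 f_cont _ (@closed_ge _ 0)).
apply: f0; move: wT; apply: closureS => _ [u u0 <-] /=.
rewrite fS /S big_seq sumr_ge0 // => p /u0 [p1 p2].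
by rewrite mulr_ge0 ?A0 ?B0.
Qed.

End FremlinTensor.

(** * Truncations to an n by n block of coordinates *)

Section Truncation.
Context {R : realType} {V : normedModType R}.
Variables (c : nat * nat -> {scalar V}) (u : nat * nat -> V) (n : nat).

(** For the product coordinates this is P_n tensor Q_n, written so that it is defined on the whole
    completion. *)
Definition truncation (w : V) : V :=
  \sum_(i < n) \sum_(j < n) c (i : nat, j : nat) w *: u (i : nat, j : nat).

Fact truncation_is_linear : linear truncation.
Proof.
move=> a x y; rewrite /truncation scaler_sumr -big_split; apply: eq_bigr => i _.
rewrite scaler_sumr -big_split /=; apply: eq_bigr => j _.
by rewrite linearP scalerDl scalerA.
Qed.

HB.instance Definition _ :=
  GRing.isLinear.Build R V V *:%R truncation truncation_is_linear.

Lemma truncation_continuous :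
  (forall p, continuous (c p : V -> R)) -> continuous truncation.
Proof.
move=> c_cont w; rewrite /truncation.
apply: cvg_big => [|i _]; first exact: add_continuous.
apply: cvg_big => [|j _]; first exact: add_continuous.
by apply: cvgZr_tmp; exact: c_cont.
Qed.

End Truncation.

(** * Coordinates and order of the tensor product *)

Section TensorBasis.
Context {R : realType} {E F T : banachLatticeType R}.
Context {tens : {bilinear E -> F -> T}}.
Hypothesis hT : is_fremlin_tensor tens.
Context {e : nat -> E} {f : nat -> F}.
Context {cE : nat -> {scalar E}} {cF : nat -> {scalar F}}.
Hypothesis eP : coordinate_system cE e.
Hypothesis fP : coordinate_system cF f.
Hypothesis e_cvg : forall x, partial_sum cE e n x @[n --> \oo] --> x.
Hypothesis f_cvg : forall y, partial_sum cF f n y @[n --> \oo] --> y.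
Let u (p : nat * nat) : T := tens (e p.1) (f p.2).

Context {c : nat * nat -> {scalar T}}.
Hypothesis c_cont : forall p, continuous (c p : T -> R).
Hypothesis c_tens : forall p x y, c p (tens x y) = cE p.1 x * cF p.2 y.
Hypothesis c_ge0 : forall p w, bl_le 0 w -> 0 <= c p w.

Lemma truncation_tens n x y :
  truncation c u n (tens x y) =
  tens (partial_sum cE e n x) (partial_sum cF f n y).
Proof.
rewrite /truncation /partial_sum /series /= !big_mkord linear_sumlz.
apply: eq_bigr => i _; rewrite linear_sumr; apply: eq_bigr => j _.
by rewrite c_tens linearZl linearZr /= scalerA.
Qed.

Lemma truncation_induced n s :
  truncation c u n (induced tens s) =
  induced (bilinear_precomp tens (partial_sum cE e n) (partial_sum cF f n)) s.
Proof.
by rewrite /induced linear_sum; apply: eq_bigr => p _; exact: truncation_tens.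
Qed.

(** The inequality is a closed condition, so algebraic tensors suffice; there the truncation is
    induced by a positive contractive bilinear map. *)
Lemma truncation_norm_le n w : `|truncation c u n w| <= `|w|.
Proof.
suff : [set w | `|truncation c u n w| - `|w| <= 0] w by rewrite /= subr_le0.
apply: (dense_closed (fremlin_dense hT)) => [|_ [s _ <-] /=].
  have g_cont : continuous (fun w => `|truncation c u n w| - `|w|).
    move=> v; apply: cvgB; apply: cvg_norm; last exact: cvg_id.
    exact: truncation_continuous.
  exact: ((continuous_closedP _).1 g_cont _ (@closed_le _ 0)).
rewrite subr_le0 truncation_induced; apply: (induced_le hT) => [x y x0 y0|x y].
  by apply: (tens_ge0 hT); exact: coord_partial_sum_ge0.
rewrite (le_trans (tens_norm_le hT _ _))//.
by rewrite ler_pM//; exact: coord_partial_sum_norm_le.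
Qed.

Lemma truncation_tens_cvg x y :
  truncation c u n (tens x y) @[n --> \oo] --> tens x y.
Proof.
apply/subr_cvg0; apply/norm_cvg0P.
pose g n := `|partial_sum cE e n x - x| * `|y| +
            `|x| * `|partial_sum cF f n y - y|.
apply: (@squeeze_cvgr _ _ _ _ (fun=> 0) g); [|exact: cvg_cst|].
  near=> n; rewrite normr_ge0 /= truncation_tens /g.
  set P := partial_sum cE e n x; set Q := partial_sum cF f n y.
  have -> : tens P Q - tens x y = tens (P - x) Q + tens x (Q - y).
    by rewrite linearBl linearBr addrA subrK.
  rewrite (le_trans (ler_normD _ _))//.
  refine (lerD (le_trans (tens_norm_le hT _ _) _) (tens_norm_le hT _ _)).
  by rewrite ler_wpM2l//; exact: coord_partial_sum_norm_le.
have -> : 0 = 0 * `|y| + `|x| * 0 :> R by rewrite mul0r mulr0 addr0.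
apply: cvgD; [apply: cvgMr_tmp|apply: cvgMl_tmp].
  by apply/norm_cvg0P/subr_cvg0.
by apply/norm_cvg0P/subr_cvg0.
Unshelve. all: by end_near. Qed.

(** Convergence on elementary tensors extends linearly to algebraic ones, and by uniform
    contractivity to their limits, with three errors of [eps / 3]. *)
Lemma truncation_cvg w : truncation c u n w @[n --> \oo] --> w.
Proof.
apply/cvgrPdist_lt => eps eps0.
have eps3 : 0 < eps / 3 by rewrite divr_gt0.
have [_ [s _ <-] ws] := dense_near w (fremlin_dense hT) eps3.
set v := induced tens s in ws.
have v_cvg : truncation c u n v @[n --> \oo] --> v.
  rewrite /v /induced; under eq_fun do rewrite linear_sum.
  apply: cvg_big => [|p _]; first exact: add_continuous.
  exact: truncation_tens_cvg.
move/cvgrPdist_lt: v_cvg => /(_ _ eps3) v_cvg.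
near=> n.
have -> : w - truncation c u n w =
    (w - v) + (v - truncation c u n v) - truncation c u n (w - v).
  by rewrite linearB /= addrA subrK opprB addrA subrK.
have -> : eps = eps / 3 + eps / 3 + eps / 3 by field.
rewrite (le_lt_trans (ler_normB _ _))// ltrD//.
  rewrite (le_lt_trans (ler_normD _ _))// ltrD//.
  by near: n.
by rewrite (le_lt_trans (truncation_norm_le _ _)).
Unshelve. all: by end_near. Qed.

(** If all coordinates of [w] are nonnegative, its truncations are nonnegative combinations of
    positive vectors, and their limit [w] stays in the closed cone. *)
Lemma tensor_coordinate_system : coordinate_system c u.
Proof.
split=> [p [k l]|w].
  by rewrite c_tens (coord_unit eP) (coord_unit fP) -natrM mulnb -pair_eqE.
split=> [w0 p|w0]; first exact: c_ge0.
apply: (closed_cvg _ (closed_bl_ge0 hT) _ w (@truncation_cvg w)).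
near=> n; apply: bl_sumr_ge0 => i _; apply: bl_sumr_ge0 => j _.
apply: bl_scale_ge0; first exact: w0.
by apply: (tens_ge0 hT);
  [exact: (coord_unit_ge0 eP)|exact: (coord_unit_ge0 fP)].
Unshelve. all: by end_near. Qed.

Lemma finite_support_dense :
  dense [set w | exists r : seq (nat * nat), forall p, p \notin r -> c p w = 0].
Proof.
move=> O [w Ow] oO.
have [n _ /(_ n (leqnn n)) On] :=
  @truncation_cvg w _ (open_nbhs_nbhs (conj oO Ow)).
exists (truncation c u n w); split=> //.
exists [seq (i, j) | i <- iota 0 n, j <- iota 0 n] => p pn.
rewrite /truncation linear_sum big1 //= => i _.
rewrite linear_sum big1 //= => j _.
rewrite linearZ /= (coord_unit tensor_coordinate_system).
case: eqP => [pij|_]; last by rewrite mulr0.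
by move: pn; rewrite pij allpairs_f// mem_iota /=.
Qed.

End TensorBasis.

Theorem lemma22 (R : realType) (E F : banachLatticeType R)
    (e : nat -> E) (f : nat -> F)
    (T : banachLatticeType R) (tens : {bilinear E -> F -> T}%R)
    (he : lattice_basis e) (hf : lattice_basis f)
    (hT : is_fremlin_tensor tens) :
  disjoint_family (fun p : nat * nat => tens (e p.1) (f p.2)) /\
  (forall s : nat -> nat * nat, bijective s ->
     one_unconditional_basis (fun n : nat => tens (e (s n).1) (f (s n).2))).
Proof.
have [cE eP e_cvg] := lattice_basis_coordinates he.
have [cF fP f_cvg] := lattice_basis_coordinates hf.
have /choice [c cP] : forall p : nat * nat, exists g : {scalar T},
    [/\ continuous (g : T -> R),
      forall x y, g (tens x y) = cE p.1 x * cF p.2 y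
      & forall w, bl_le 0 w -> 0 <= g w].
  (* This [k] is the product of the constants in [coord_bound] for the two factors. *)
  move=> p; apply: (tensor_functional hT (k := `|e p.1| * `|f p.2|)).
  - by rewrite mulr_gt0 ?(coord_unit_gt0 eP) ?(coord_unit_gt0 fP).
  - move=> x y; rewrite mulrACA ler_pM ?mulr_ge0//.
      exact: (coord_bound eP).
    exact: (coord_bound fP).
  - by move=> x /(coord_ge0 eP).
  - by move=> y /(coord_ge0 fP).
have c_cont p : continuous (c p : T -> R) by case: (cP p).
have c_tens p x y : c p (tens x y) = cE p.1 x * cF p.2 y by case: (cP p).
have c_ge0 p w : bl_le 0 w -> 0 <= c p w by case: (cP p) => _ _; apply.
have cu := tensor_coordinate_system hT eP fP e_cvg f_cvg c_cont c_tens c_ge0.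
split; first exact: (coord_disjoint cu).
move=> s s_bij; apply: (coord_one_unconditional cu s_bij).
exact: (finite_support_dense hT eP fP e_cvg f_cvg c_cont c_tens c_ge0).
Qed.
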